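(* Let $A\in\mathbb{H}^{m\times n}$, $B\in\mathbb{H}^{m\times p_1}$, $C\in\mathbb{H}^{m\times p_2}$, $D\in\mathbb{H}^{q_1\times n}$, $E\in\mathbb{H}^{q_2\times n}$ be given. Then the real quaternion matrix equation $BXD+CYE=A$ (with unknowns $X\in\mathbb{H}^{p_1\times q_1}$, $Y\in\mathbb{H}^{p_2\times q_2}$) is consistent if and only if $$r\begin{bmatrix}A&C&B\end{bmatrix}=r\begin{bmatrix}C&B\end{bmatrix},\quad r\begin{bmatrix}A\\ D\\ E\end{bmatrix}=r\begin{bmatrix}D\\ E\end{bmatrix},\quad r\begin{bmatrix}A&B\\ E&0\end{bmatrix}=r\begin{bmatrix}0&B\\ E&0\end{bmatrix},\quad r\begin{bmatrix}A&C\\ D&0\end{bmatrix}=r\begin{bmatrix}0&C\\ D&0\end{bmatrix}.$$ In this case, the general solution can be expressed as $$X=T_1^{-1}\begin{bmatrix}A_1&A_2&X_3\\ A_4&X_5&X_6\\ X_7&X_8&X_9\end{bmatrix}V_1^{-1},\qquad Y=T_2^{-1}\begin{bmatrix}Y_1&Y_2&Y_3\\ Y_4&A_5-X_5&A_6\\ Y_7&A_8&A_9\end{bmatrix}V_2^{-1},$$ where $A_1,A_2,A_4,A_5,A_6,A_8,A_9,T_1,V_1,T_2,V_2$ come from the simultaneous decomposition of $A,B,C,D,E$ described in the context, and $X_3,X_5,X_6,X_7,X_8,X_9,Y_1,Y_2,Y_3,Y_4,Y_7$ are arbitrary real quaternion matrices of compatible sizes.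
   Context: $\mathbb{H}$ is the real quaternion algebra and $\mathbb{H}^{m\times n}$ is the set of $m\times n$ matrices over $\mathbb{H}$. The rank $r(M)$ of a quaternion matrix $M$ is the dimension of its column right space (equivalently, of its row left space). Simultaneous decomposition of $A,B,C,D,E$ (one always exists; fix one): nonsingular matrices $P\in\mathbb{H}^{m\times m}$, $Q\in\mathbb{H}^{n\times n}$, $T_1\in\mathbb{H}^{p_1\times p_1}$, $T_2\in\mathbb{H}^{p_2\times p_2}$, $V_1\in\mathbb{H}^{q_1\times q_1}$, $V_2\in\mathbb{H}^{q_2\times q_2}$ such that $A=PS_AQ$, $B=PS_BT_1$, $C=PS_CT_2$, $D=V_1S_DQ$, $E=V_2S_EQ$, where $$S_A=\begin{bmatrix}0&0&0&0&0&I_{m_1}&0\\ 0&A_1&A_2&A_3&0&0&0\\ 0&A_4&A_5&A_6&0&0&0\\ 0&A_7&A_8&A_9&0&0&0\\ 0&0&0&0&I_{m_5}&0&0\\ I_{m_6}&0&0&0&0&0&0\\ 0&0&0&0&0&0&0\end{bmatrix},\quad S_B=\begin{bmatrix}0&0&B_1\\ I_{m_2}&0&0\\ 0&I_{m_3}&0\\ 0&0&0\\ 0&0&0\\ 0&0&0\\ 0&0&0\end{bmatrix},\quad S_C=\begin{bmatrix}C_1&C_2&0\\ 0&0&0\\ 0&I_{m_3}&0\\ 0&0&I_{m_4}\\ 0&0&0\\ 0&0&0\\ 0&0&0\end{bmatrix},$$ $$S_D=\begin{bmatrix}0&I_{n_2}&0&0&0&0&0\\ 0&0&I_{n_3}&0&0&0&0\\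 D_1&0&0&0&0&0&0\end{bmatrix},\quad S_E=\begin{bmatrix}E_1&0&0&0&0&0&0\\ E_2&0&I_{n_3}&0&0&0&0\\ 0&0&0&I_{n_4}&0&0&0\end{bmatrix}.$$ Here $m_1+m_5+m_6=r\begin{bmatrix}A&B&C\end{bmatrix}+r\begin{bmatrix}A\\ D\\ E\end{bmatrix}-\rho$, $m_2=\rho-r\begin{bmatrix}A&C\\ D&0\\ E&0\end{bmatrix}$, $m_4=\rho-r\begin{bmatrix}A&B\\ D&0\\ E&0\end{bmatrix}$, $m_3=r\begin{bmatrix}A&B\\ D&0\\ E&0\end{bmatrix}+r\begin{bmatrix}A&C\\ D&0\\ E&0\end{bmatrix}-\rho-r\begin{bmatrix}A\\ D\\ E\end{bmatrix}$, $n_2=\rho-r\begin{bmatrix}A&B&C\\ E&0&0\end{bmatrix}$, $n_4=\rho-r\begin{bmatrix}A&B&C\\ D&0&0\end{bmatrix}$, $n_3=r\begin{bmatrix}A&B&C\\ D&0&0\end{bmatrix}+r\begin{bmatrix}A&B&C\\ E&0&0\end{bmatrix}-\rho-r\begin{bmatrix}A&B&C\end{bmatrix}$, with $\rho=r\begin{bmatrix}A&B&C\\ D&0&0\\ E&0&0\end{bmatrix}$. Blocks may be empty (size zero). The block rows of $S_A,S_B,S_C$ have sizes $m_1,m_2,m_3,m_4,m_5,m_6,m-\sum_{i=1}^6 m_i$; the block columns of $S_A,S_D,S_E$ have sizes $m_6,n_2,n_3,n_4,m_5,m_1,n-(m_1+m_5+m_6+n_2+n_3+n_4)$; the block columns of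 $S_B$ have sizes $m_2,m_3,p_1-m_2-m_3$; the block columns of $S_C$ have sizes $p_2-m_3-m_4,m_3,m_4$; the block rows of $S_D$ have sizes $n_2,n_3,q_1-n_2-n_3$; the block rows of $S_E$ have sizes $q_2-n_3-n_4,n_3,n_4$. Accordingly, the $3\times3$ block matrix in $X$ has block row sizes $m_2,m_3,p_1-m_2-m_3$ and block column sizes $n_2,n_3,q_1-n_2-n_3$; the one in $Y$ has block row sizes $p_2-m_3-m_4,m_3,m_4$ and block column sizes $q_2-n_3-n_4,n_3,n_4$. *)

(* Defs.v *)
From HB Require Import structures.
From mathcomp Require Import all_boot all_order all_algebra.
From mathcomp Require Import ring.
From mathcomp Require Import boolp classical_sets reals.

Set Implicit Arguments.
Unset Strict Implicit.
Unset Printing Implicit Defensive.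

Import Order.TTheory GRing.Theory Num.Theory.
Local Open Scope classical_set_scope.
Local Open Scope ring_scope.

(* [Quat a b c d] is the real quaternion a + b i + c j + d k. *)
Record quat (R : realType) : Type :=
  Quat { qre : R; qim_i : R; qim_j : R; qim_k : R }.

Section QuaternionRing.
Variable R : realType.
Implicit Types x y z : quat R.

Definition quat_tuple x := ((qre x, qim_i x), (qim_j x, qim_k x)).
Definition tuple_quat (t : (R * R) * (R * R)) :=
  Quat t.1.1 t.1.2 t.2.1 t.2.2.

Lemma quat_tupleK : cancel quat_tuple tuple_quat.
Proof. by case. Qed.

HB.instance Definition _ := Choice.copy (quat R) (can_type quat_tupleK).

Definition quat_zero : quat R := Quat 0 0 0 0.
Definition quat_one : quat R := Quat 1 0 0 0.
Definition quat_opp x := Quat (- qre x) (- qim_i x) (- qim_j x) (- qim_k x).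
Definition quat_add x y :=
  Quat (qre x + qre y) (qim_i x + qim_i y)
       (qim_j x + qim_j y) (qim_k x + qim_k y).

(* Hamilton's rules i^2 = j^2 = k^2 = ijk = -1, extended R-bilinearly. *)
Definition quat_mul x y :=
  let: Quat a b c d := x in let: Quat a' b' c' d' := y in
  Quat (a * a' - b * b' - c * c' - d * d')
       (a * b' + b * a' + c * d' - d * c')
       (a * c' - b * d' + c * a' + d * b')
       (a * d' + b * c' - c * b' + d * a').

Lemma quat_addA : associative quat_add.
Proof. by move=> x y z; rewrite /quat_add /= !addrA. Qed.

Lemma quat_addC : commutative quat_add.
Proof. by move=> x y; rewrite /quat_add; congr Quat; rewrite addrC. Qed.

Lemma quat_add0 : left_id quat_zero quat_add.
Proof. by case=> a b c d; rewrite /quat_add /= !add0r. Qed.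

Lemma quat_addN : left_inverse quat_zero quat_opp quat_add.
Proof. by case=> a b c d; rewrite /quat_add /= !addNr. Qed.

HB.instance Definition _ :=
  GRing.isZmodule.Build (quat R) quat_addA quat_addC quat_add0 quat_addN.

Lemma quat_mulA : associative quat_mul.
Proof. by move=> [????] [????] [????] /=; congr Quat; ring. Qed.

Lemma quat_mul1l : left_id quat_one quat_mul.
Proof. by move=> [????] /=; congr Quat; ring. Qed.

Lemma quat_mul1r : right_id quat_one quat_mul.
Proof. by move=> [????] /=; congr Quat; ring. Qed.

Lemma quat_mulDl : left_distributive quat_mul +%R.
Proof. by move=> [????] [????] [????] /=; congr Quat => /=; ring. Qed.

Lemma quat_mulDr : right_distributive quat_mul +%R.
Proof. by move=> [????] [????] [????] /=; congr Quat => /=; ring. Qed.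

Lemma quat_one_neq0 : quat_one != 0.
Proof. by apply/eqP => -[] /eqP; rewrite oner_eq0. Qed.

HB.instance Definition _ := GRing.Zmodule_isNzRing.Build (quat R)
  quat_mulA quat_mul1l quat_mul1r quat_mulDl quat_mulDr quat_one_neq0.

Definition quat_normsq x :=
  qre x ^+ 2 + qim_i x ^+ 2 + qim_j x ^+ 2 + qim_k x ^+ 2.

Definition quat_inv x :=
  Quat (qre x / quat_normsq x) (- qim_i x / quat_normsq x)
       (- qim_j x / quat_normsq x) (- qim_k x / quat_normsq x).

Lemma quat_normsq_eq0 x : (quat_normsq x == 0) = (x == 0).
Proof.
case: x => a b c d; rewrite /quat_normsq /=.
rewrite !paddr_eq0 ?addr_ge0 ?sqr_ge0 // !sqrf_eq0.
apply/idP/eqP => [|[-> -> -> ->]]; last by rewrite eqxx.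
by move=> /andP[/andP[/andP[/eqP-> /eqP->] /eqP->] /eqP->].
Qed.

Lemma quat_mulVx x : x != 0 -> quat_inv x * x = 1.
Proof.
rewrite -quat_normsq_eq0; case: x => a b c d; rewrite /quat_normsq /= => n0.
by rewrite /GRing.mul /GRing.one /=; congr Quat; rewrite /quat_normsq /=; field.
Qed.

Lemma quat_mulxV x : x != 0 -> x * quat_inv x = 1.
Proof.
rewrite -quat_normsq_eq0; case: x => a b c d; rewrite /quat_normsq /= => n0.
by rewrite /GRing.mul /GRing.one /=; congr Quat; rewrite /quat_normsq /=; field.
Qed.

Lemma quat_unitP x y : y * x = 1 /\ x * y = 1 -> x != 0.
Proof.
by case=> + _; apply: contra_eq_neq => ->; rewrite mulr0 eq_sym oner_eq0.
Qed.

Lemma quat_inv0 : {in [predC [pred x : quat R | x != 0]], quat_inv =1 id}.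
Proof.
move=> x; rewrite !inE negbK => /eqP ->.
by rewrite /quat_inv /= oppr0 mul0r.
Qed.

HB.instance Definition _ := GRing.NzRing_hasMulInverse.Build (quat R)
  quat_mulVx quat_mulxV quat_unitP quat_inv0.

End QuaternionRing.

(* MathComp's [\rank] and [invmx] need commutative scalars, so rank and inverse
   are redefined here for matrices over a possibly noncommutative ring. *)
Section NoncommutativeMatrices.
Variable K : nzRingType.

(* The right span of the columns of [b]; in [b *m x] the scalars in [x]
   multiply the columns of [b] from the right. *)
Definition right_span m k (b : 'M[K]_(m, k)) : set 'cV[K]_m :=
  [set b *m x | x in [set: 'cV[K]_k]].

Definition right_free m k (b : 'M[K]_(m, k)) : Prop :=
  forall x : 'cV[K]_k, b *m x = 0 -> x = 0.

Definition right_basis m k (b : 'M[K]_(m, k)) (V : set 'cV[K]_m) : Prop :=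
  right_free b /\ right_span b = V.

(* The common number of elements of the bases of [V]. The default value 0 is
   not met when [K] is a division ring and [V] is a right subspace. *)
Definition right_dim m (V : set 'cV[K]_m) : nat :=
  xget 0%N [set k | exists b : 'M[K]_(m, k), right_basis b V].

Definition rank m n (M : 'M[K]_(m, n)) : nat := right_dim (right_span M).

Definition is_mxinverse n (P P' : 'M[K]_n) : Prop :=
  P *m P' = 1%:M /\ P' *m P = 1%:M.

Definition nonsingular n (P : 'M[K]_n) : Prop :=
  exists P', is_mxinverse P P'.

(* [0] when [P] is singular. *)
Definition mxinverse n (P : 'M[K]_n) : 'M[K]_n :=
  xget 0 [set P' | is_mxinverse P P'].

Definition row3 m n1 n2 n3 (a1 : 'M[K]_(m, n1)) (a2 : 'M[K]_(m, n2))
    (a3 : 'M[K]_(m, n3)) : 'M[K]_(m, n1 + (n2 + n3)) :=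
  row_mx a1 (row_mx a2 a3).

Definition col3 m1 m2 m3 n (a1 : 'M[K]_(m1, n)) (a2 : 'M[K]_(m2, n))
    (a3 : 'M[K]_(m3, n)) : 'M[K]_(m1 + (m2 + m3), n) :=
  col_mx a1 (col_mx a2 a3).

Definition row7 m n1 n2 n3 n4 n5 n6 n7
    (a1 : 'M[K]_(m, n1)) (a2 : 'M[K]_(m, n2)) (a3 : 'M[K]_(m, n3))
    (a4 : 'M[K]_(m, n4)) (a5 : 'M[K]_(m, n5)) (a6 : 'M[K]_(m, n6))
    (a7 : 'M[K]_(m, n7)) :
    'M[K]_(m, n1 + (n2 + (n3 + (n4 + (n5 + (n6 + n7)))))) :=
  row_mx a1 (row_mx a2 (row_mx a3 (row_mx a4 (row_mx a5 (row_mx a6 a7))))).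

Definition col7 m1 m2 m3 m4 m5 m6 m7 n
    (a1 : 'M[K]_(m1, n)) (a2 : 'M[K]_(m2, n)) (a3 : 'M[K]_(m3, n))
    (a4 : 'M[K]_(m4, n)) (a5 : 'M[K]_(m5, n)) (a6 : 'M[K]_(m6, n))
    (a7 : 'M[K]_(m7, n)) :
    'M[K]_(m1 + (m2 + (m3 + (m4 + (m5 + (m6 + m7))))), n) :=
  col_mx a1 (col_mx a2 (col_mx a3 (col_mx a4 (col_mx a5 (col_mx a6 a7))))).

End NoncommutativeMatrices.

(* The sizes that are differences in the literature (m minus the sum of the m_i,
   p1 - m2 - m3, and so on) are the fields [sd_m7], [sd_n7], [sd_p3], [sd_p1'],
   [sd_q3], [sd_q1'], tied to m, n, p1, p2, q1, q2 by the equations [sd_eqm],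
   ..., [sd_eqq2]; the dimensions of the block matrices are cast along these. *)
Record simdec (R : realType) (m n p1 p2 q1 q2 : nat)
    (A : 'M[quat R]_(m, n)) (B : 'M[quat R]_(m, p1)) (C : 'M[quat R]_(m, p2))
    (D : 'M[quat R]_(q1, n)) (E : 'M[quat R]_(q2, n)) : Type := SimDec {
  sd_m1 : nat; sd_m2 : nat; sd_m3 : nat; sd_m4 : nat; sd_m5 : nat; sd_m6 : nat;
  sd_m7 : nat;
  sd_n2 : nat; sd_n3 : nat; sd_n4 : nat; sd_n7 : nat;
  sd_p3 : nat; sd_p1' : nat; sd_q3 : nat; sd_q1' : nat;
  sd_eqm : (sd_m1 + (sd_m2 + (sd_m3 + (sd_m4 + (sd_m5 + (sd_m6 + sd_m7)))))
              = m)%N;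
  sd_eqn : (sd_m6 + (sd_n2 + (sd_n3 + (sd_n4 + (sd_m5 + (sd_m1 + sd_n7)))))
              = n)%N;
  sd_eqp1 : (sd_m2 + (sd_m3 + sd_p3) = p1)%N;
  sd_eqp2 : (sd_p1' + (sd_m3 + sd_m4) = p2)%N;
  sd_eqq1 : (sd_n2 + (sd_n3 + sd_q3) = q1)%N;
  sd_eqq2 : (sd_q1' + (sd_n3 + sd_n4) = q2)%N;
  sd_P : 'M[quat R]_m;
  sd_Q : 'M[quat R]_n;
  sd_T1 : 'M[quat R]_p1;
  sd_T2 : 'M[quat R]_p2;
  sd_V1 : 'M[quat R]_q1;
  sd_V2 : 'M[quat R]_q2;
  sd_A1 : 'M[quat R]_(sd_m2, sd_n2);
  sd_A2 : 'M[quat R]_(sd_m2, sd_n3);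
  sd_A3 : 'M[quat R]_(sd_m2, sd_n4);
  sd_A4 : 'M[quat R]_(sd_m3, sd_n2);
  sd_A5 : 'M[quat R]_(sd_m3, sd_n3);
  sd_A6 : 'M[quat R]_(sd_m3, sd_n4);
  sd_A7 : 'M[quat R]_(sd_m4, sd_n2);
  sd_A8 : 'M[quat R]_(sd_m4, sd_n3);
  sd_A9 : 'M[quat R]_(sd_m4, sd_n4);
  sd_B1 : 'M[quat R]_(sd_m1, sd_p3);
  sd_C1 : 'M[quat R]_(sd_m1, sd_p1');
  sd_C2 : 'M[quat R]_(sd_m1, sd_m3);
  sd_D1 : 'M[quat R]_(sd_q3, sd_m6);
  sd_E1 : 'M[quat R]_(sd_q1', sd_m6);
  sd_E2 : 'M[quat R]_(sd_n3, sd_m6);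
  sd_nsP : nonsingular sd_P;
  sd_nsQ : nonsingular sd_Q;
  sd_nsT1 : nonsingular sd_T1;
  sd_nsT2 : nonsingular sd_T2;
  sd_nsV1 : nonsingular sd_V1;
  sd_nsV2 : nonsingular sd_V2;
  sd_eqA : A = sd_P *m castmx (sd_eqm, sd_eqn) (col7
    (row7 0     0     0     0     0     1%:M  0)
    (row7 0     sd_A1 sd_A2 sd_A3 0     0     0)
    (row7 0     sd_A4 sd_A5 sd_A6 0     0     0)
    (row7 0     sd_A7 sd_A8 sd_A9 0     0     0)
    (row7 0     0     0     0     1%:M  0     0)
    (row7 1%:M  0     0     0     0     0     0)
    (row7 0     0     0     0     0     0     0)) *m sd_Q;
  sd_eqB : B = sd_P *m castmx (sd_eqm, sd_eqp1) (col7
    (row3 0     0     sd_B1)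
    (row3 1%:M  0     0)
    (row3 0     1%:M  0)
    (row3 0     0     0)
    (row3 0     0     0)
    (row3 0     0     0)
    (row3 0     0     0)) *m sd_T1;
  sd_eqC : C = sd_P *m castmx (sd_eqm, sd_eqp2) (col7
    (row3 sd_C1 sd_C2 0)
    (row3 0     0     0)
    (row3 0     1%:M  0)
    (row3 0     0     1%:M)
    (row3 0     0     0)
    (row3 0     0     0)
    (row3 0     0     0)) *m sd_T2;
  sd_eqD : D = sd_V1 *m castmx (sd_eqq1, sd_eqn) (col3
    (row7 0     1%:M  0     0     0     0     0)
    (row7 0     0     1%:M  0     0     0     0)
    (row7 sd_D1 0     0     0     0     0     0)) *m sd_Q;
  sd_eqE : E = sd_V2 *m castmx (sd_eqq2, sd_eqn) (col3
    (row7 sd_E1 0     0     0     0     0     0)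
    (row7 sd_E2 0     1%:M  0     0     0     0)
    (row7 0     0     0     1%:M  0     0     0)) *m sd_Q;
  sd_rank : let rho := (rank (col3 (row3 A B C) (row3 D 0 0) (row3 E 0 0)))%:Z in
    let rABC := (rank (row3 A B C))%:Z in
    let rADE := (rank (col3 A D E))%:Z in
    let rAB := (rank (col3 (row_mx A B) (row_mx D 0) (row_mx E 0)))%:Z in
    let rAC := (rank (col3 (row_mx A C) (row_mx D 0) (row_mx E 0)))%:Z in
    let rABC_D := (rank (col_mx (row3 A B C) (row3 D 0 0)))%:Z in
    let rABC_E := (rank (col_mx (row3 A B C) (row3 E 0 0)))%:Z in
    [/\ (sd_m1 + sd_m5 + sd_m6)%N%:Z = rABC + rADE - rho,
        sd_m2%:Z = rho - rAC /\ sd_m4%:Z = rho - rAB,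
        sd_m3%:Z = rAB + rAC - rho - rADE,
        sd_n2%:Z = rho - rABC_E /\ sd_n4%:Z = rho - rABC_D
      & sd_n3%:Z = rABC_D + rABC_E - rho - rABC]
}.

(* Main.v *)
Require Import Defs.
From mathcomp Require Import all_boot all_order all_algebra.
From mathcomp Require Import boolp classical_sets reals.
Set Implicit Arguments.
Unset Strict Implicit.
Unset Printing Implicit Defensive.
Import Order.TTheory GRing.Theory Num.Theory.
Local Open Scope ring_scope.

(* Over a division ring every matrix M has a full rank factorization, hence an
   inner inverse M' (M M' M = M); equality of the rank of a matrix and of one
   of its one-sided multiples makes the former a multiple of the latter.
   So the four rank equalities say that A has the forms C Z + B W, Z D + W E,
   B Z + W E and C Z + W D. With RB := 1 - B B', LD := 1 - D' D, G := RB C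
   and H := E LD, these forms make the equations G Y E = RB A and
   C Y H = A LD separately solvable; a common solution Y exists, and then
   X := B' (A - C Y E) D' completes it (Baksalary-Kala).

   For the general solution, the equation is transported to the canonical
   matrices and compared block by block: consistency forces
   m1 = m5 = m6 = 0, A3 = 0 and A7 = 0, and the remaining blocks give the
   parametrization. *)

(** * One-sided inverses and full rank factorizations over a division ring *)

Definition is_division_ring (K : unitRingType) : Prop :=
  forall x : K, x != 0 -> x \is a GRing.unit.

Lemma quat_division_ring (R : realType) : is_division_ring (quat R).
Proof. by move=> x. Qed.

Section DivisionRing.
Variable K : unitRingType.

(** The row holds the inverse of one nonzero entry of [g], at the position of that entry. *)
Lemma col_left_inverse (divK : is_division_ring K) m (g : 'cV[K]_m) : g != 0 ->
  exists r : 'rV[K]_m, r *m g = 1%:M.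
Proof.
case/cV0Pn=> i gi0.
exists (\row_j ((g i 0)^-1 *+ (j == i))); apply/matrixP => a b.
rewrite !ord1 !mxE (bigD1 i) //= big1 ?addr0 ?mxE ?eqxx ?mulVr ?divK //.
by move=> j /negPf ji; rewrite mxE ji mulr0n mul0r.
Qed.

(** [P = 1 - f h] kills [f] but not [b], so some row [r P] is 1 on [b] and 0 on [f]. Subtracting
    [h b] times that row from [h] makes [h] vanish on [b] without changing its product with [f]. *)
Lemma extend_left_inverse (divK : is_division_ring K) m k (f : 'M[K]_(m, k))
    (h : 'M[K]_(k, m)) (b : 'cV[K]_m) :
  h *m f = 1%:M -> (1%:M - f *m h) *m b != 0 ->
  exists h' : 'M[K]_(1 + k, m), h' *m row_mx b f = 1%:M.
Proof.
move=> hf /(col_left_inverse divK)[r].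
set P := 1%:M - _ => rPb.
have Pf : P *m f = 0 by rewrite mulmxBl mul1mx -mulmxA hf mulmx1 subrr.
rewrite mulmxA in rPb.
exists (col_mx (r *m P) (h - h *m b *m (r *m P))).
rewrite mul_col_row !mulmxBl rPb -!mulmxA Pf !mulmx0 subr0 hf [r *m _]mulmxA.
by rewrite rPb mulmx1 subrr -scalar_mx_block.
Qed.

(** Induction on the columns: a new column [b] either equals [f (h b)] and leaves [f] unchanged, or
    is adjoined to [f]. The matrix [y] keeps [f] in the column span of [M], and [h] keeps its
    columns independent. *)
Lemma full_rank_factorization (divK : is_division_ring K) m n
    (M : 'M[K]_(m, n)) :
  exists k (f : 'M[K]_(m, k)) (x : 'M[K]_(k, n)) (y : 'M[K]_(n, k))
    (h : 'M[K]_(k, m)), [/\ M = f *m x, f = M *m y & h *m f = 1%:M].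
Proof.
elim: n M => [|n IHn]; last rewrite -add1n => M.
  move=> M; exists 0%N, 0, 0, 0, 0.
  by split; rewrite ?flatmx0 ?mulmx0 // thinmx0.
rewrite -[M]hsubmxK; set b := lsubmx M; set M' := rsubmx M.
have [k [f [x [y [h [Mfx fMy hf]]]]]] := IHn M'.
have [/eqP|] := eqVneq ((1%:M - f *m h) *m b) 0.
  rewrite mulmxBl mul1mx subr_eq0 => /eqP bE.
  exists k, f, (row_mx (h *m b) x), (col_mx 0 y), h; split=> //.
    by rewrite mul_mx_row -Mfx mulmxA -bE.
  by rewrite mul_row_col mulmx0 add0r.
move=> /(extend_left_inverse divK hf)[h' h'E].
exists (1 + k)%N, (row_mx b f).
exists (block_mx 1%:M 0 0 x), (block_mx 1%:M 0 0 y), h'.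
by split=> //; rewrite mul_row_block !mulmx0 !mulmx1 add0r addr0 -?Mfx -?fMy.
Qed.

(** Gaussian elimination, one column and one row at a time. This is the only counting argument;
    invariance of dimension rests on it. *)
Lemma left_inverse_dim_le (divK : is_division_ring K) m k
    (f : 'M[K]_(m, k)) (h : 'M[K]_(k, m)) :
  h *m f = 1%:M -> (k <= m)%N.
Proof.
elim: k m f h => [//|k IHk] m f h hf.
pose b := lsubmx (f : 'M_(m, 1 + k)); pose f' := rsubmx (f : 'M_(m, 1 + k)).
pose r := usubmx (h : 'M_(1 + k, m)); pose h' := dsubmx (h : 'M_(1 + k, m)).
have : col_mx r h' *m row_mx b f' = 1%:M :> 'M_(1 + k).
  by rewrite vsubmxK hsubmxK.
rewrite mul_col_row scalar_mx_block => /eq_block_mx[rb _ h'b h'f'].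
have [i bi0] : exists i, b i 0 != 0.
  apply/cV0Pn; apply: contra_eq_neq rb => ->.
  rewrite mulmx0 eq_sym; apply/matrix0Pn; exists 0, 0.
  by rewrite !mxE eqxx oner_eq0.
case: m f h hf b f' r h' rb h'b h'f' i bi0
  => [|m] f h hf b f' r h' rb h'b h'f' i bi0; first by case: i {bi0}.
(* Clear row i of f' with the pivot b i 0, so that deleting it loses nothing. *)
pose f2 := f' - b *m ((b i 0)^-1 *: row i f').
have h'f2 : h' *m f2 = 1%:M by rewrite mulmxBr h'f' mulmxA h'b mul0mx subr0.
have f2i j : f2 i j = 0.
  by rewrite !mxE big_ord1 !mxE mulrA divrr ?divK // mul1r subrr.
rewrite ltnS; apply: (IHk _ (row' i f2) (col' i h')).
rewrite -h'f2; apply/matrixP => a c; rewrite !mxE [RHS](bigD1_ord i) //=.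
by rewrite f2i mulr0 add0r; apply: eq_bigr => j _; rewrite !mxE.
Qed.

Lemma mulmx1_comm (divK : is_division_ring K) k (u v : 'M[K]_k) :
  v *m u = 1%:M -> u *m v = 1%:M.
Proof.
move=> vu; apply/esym/eqP; rewrite -subr_eq0.
apply: contraT => /matrix0Pn[i [j uvij]].
(* A column killed by v would make k + 1 columns left invertible. *)
have cj : (1%:M - u *m v) *m delta_mx j (0 : 'I_1) != 0.
  by rewrite -colE; apply/matrix0Pn; exists i, 0; rewrite mxE.
have [h' /(left_inverse_dim_le divK)] := extend_left_inverse divK vu cj.
by rewrite ltnn.
Qed.

(** * Right spans and the rank *)

(** The columns of [w] are coefficient vectors, chosen one for each column of [M]. *)
Lemma right_spanP m n k (M : 'M[K]_(m, n)) (N : 'M[K]_(m, k)) :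
  (right_span M `<=` right_span N)%classic <-> exists w, M = N *m w.
Proof.
split=> [MN|[w ->] _ [x _ <-]]; last by exists (w *m x) => //; rewrite mulmxA.
have /choice[w wE] j : exists w : 'cV_k, N *m w = col j M.
  have [|w _ wE] := MN (col j M); last by exists w.
  by exists (delta_mx j 0) => //; rewrite -colE.
exists (\matrix_(i, j) w j i 0); apply/matrixP => i j.
have /matrixP/(_ i 0) := wE j; rewrite !mxE => <-.
by apply: eq_bigr => l _; rewrite mxE.
Qed.

Lemma right_span_eq m n k (M : 'M[K]_(m, n)) (N : 'M[K]_(m, k)) x y :
  M = N *m x -> N = M *m y -> right_span M = right_span N.
Proof.
by move=> MN NM; apply/seteqP; split; apply/right_spanP; [exists x|exists y].
Qed.

Lemma right_free_mulmx m n k (b : 'M[K]_(m, k)) (x y : 'M[K]_(k, n)) :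
  right_free b -> b *m x = b *m y -> x = y.
Proof.
move=> fb bxy; apply/eqP; rewrite -subr_eq0; apply/eqP/matrixP => i j.
have /matrixP/(_ i 0) : col j (x - y) = 0.
  by apply: fb; rewrite colE mulmxA mulmxBr bxy subrr mul0mx.
by rewrite !mxE.
Qed.

(** The columns of [f] form a basis of the span of [M]. The transition matrices to any other basis
    are left invertible in both directions, so all bases have [k] elements and the choice in
    [right_dim] is forced. *)
Lemma rank_factorization (divK : is_division_ring K) m n k
    (M : 'M[K]_(m, n)) (f : 'M[K]_(m, k)) (x : 'M[K]_(k, n))
    (y : 'M[K]_(n, k)) (h : 'M[K]_(k, m)) :
  M = f *m x -> f = M *m y -> h *m f = 1%:M -> rank M = k.
Proof.
move=> Mfx fMy hf; apply: xget_unique.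
  exists f; split; last exact: right_span_eq fMy Mfx.
  by move=> z fz; rewrite -[z]mul1mx -hf -mulmxA fz mulmx0.
move=> l [b [free_b /seteqP[/right_spanP[u bu] /right_spanP[v Mv]]]].
have fv : f = b *m (v *m y) by rewrite mulmxA -Mv.
have bf : b = f *m (x *m u) by rewrite mulmxA -Mfx.
apply/eqP; rewrite eqn_leq; apply/andP; split.
  apply: (@left_inverse_dim_le divK _ _ (x *m u) (v *m y)).
  by apply: (right_free_mulmx free_b); rewrite mulmx1 mulmxA -fv -bf.
apply: (@left_inverse_dim_le divK _ _ (v *m y) (h *m b)).
by rewrite -mulmxA -fv.
Qed.

(** With the inner size written as [rank M], factorizations of two matrices of equal rank can be
    compared by square matrices. *)
Lemma rank_witness (divK : is_division_ring K) m n (M : 'M[K]_(m, n)) :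
  exists (f : 'M[K]_(m, rank M)) (x : 'M[K]_(rank M, n)) (y : 'M[K]_(n, rank M))
    (h : 'M[K]_(rank M, m)), [/\ M = f *m x, f = M *m y & h *m f = 1%:M].
Proof.
have [k [f [x [y [h [Mfx fMy hf]]]]]] := full_rank_factorization divK M.
by rewrite (rank_factorization divK Mfx fMy hf); exists f, x, y, h.
Qed.

(** [M (y h)] equals [f h], which fixes [f] and hence [M = f x]. *)
Lemma inner_inverse (divK : is_division_ring K) m n (M : 'M[K]_(m, n)) :
  exists M' : 'M[K]_(n, m), M *m M' *m M = M.
Proof.
have [k [f [x [y [h [Mfx fMy hf]]]]]] := full_rank_factorization divK M.
exists (y *m h).
by rewrite mulmxA -fMy {1}Mfx mulmxA -(mulmxA f h f) hf mulmx1.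
Qed.

Lemma rank_mulr_eq m n k (M : 'M[K]_(m, n)) (N : 'M[K]_(m, k)) x y :
  M = N *m x -> N = M *m y -> rank M = rank N.
Proof. by move=> MN NM; rewrite /rank (right_span_eq MN NM). Qed.

(** The rank is defined by columns, so left multiples need an argument: a factorization [M = f z]
    gives [N = (y f) z], where [y f] has the left inverse [h x]. *)
Lemma rank_mull_eq (divK : is_division_ring K) m n k
    (M : 'M[K]_(m, n)) (N : 'M[K]_(k, n)) x y :
  M = x *m N -> N = y *m M -> rank M = rank N.
Proof.
move=> MN NM; have [f [z [t [h [Mfz fMt hf]]]]] := rank_witness divK M.
apply/esym/(@rank_factorization divK _ _ _ N (y *m f) z t (h *m x)).
- by rewrite -mulmxA -Mfz.
- by rewrite fMt mulmxA -NM.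
- by rewrite fMt !mulmxA -(mulmxA _ y M) -NM -(mulmxA h) -MN -mulmxA -fMt.
Qed.

(** The left factors satisfy [f2 = f s] with [s = x w y2] square of size the common rank. As [h2 f]
    is a left inverse of [s], it is also a right inverse, and [f = f2 (h2 f)]. *)
Lemma rank_eq_mulr (divK : is_division_ring K) m n k
    (M : 'M[K]_(m, n)) (N : 'M[K]_(m, k)) w :
  N = M *m w -> rank M = rank N -> exists z, M = N *m z.
Proof.
move=> NM rMN; have [f [x [y [h [Mfx fMy hf]]]]] := rank_witness divK M.
have := rank_witness divK N; rewrite -rMN => -[f2 [x2 [y2 [h2 [Nfx fNy hf2]]]]].
have f2E : f2 = f *m (x *m w *m y2) by rewrite !mulmxA -Mfx -NM.
have /(mulmx1_comm divK) uv : h2 *m f *m (x *m w *m y2) = 1%:M.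
  by rewrite -mulmxA -f2E.
exists (y2 *m (h2 *m f *m x)).
by rewrite mulmxA -fNy {1}f2E mulmxA -(mulmxA f) uv mulmx1.
Qed.

(** The mirror argument uses the right factors: [x2 = (h2 w f) x], and the square matrix [h2 w f] is
    invertible with inverse [x y2]. *)
Lemma rank_eq_mull (divK : is_division_ring K) m n k
    (M : 'M[K]_(m, n)) (N : 'M[K]_(k, n)) w :
  N = w *m M -> rank M = rank N -> exists z, M = z *m N.
Proof.
move=> NM rMN; have [f [x [y [h [Mfx fMy hf]]]]] := rank_witness divK M.
have := rank_witness divK N; rewrite -rMN => -[f2 [x2 [y2 [h2 [Nfx fNy hf2]]]]].
have h2N : h2 *m N = x2 by rewrite Nfx mulmxA hf2 mul1mx.
have x2E : x2 = h2 *m w *m f *m x by rewrite -h2N NM -!mulmxA -Mfx.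
have /(mulmx1_comm divK) uv : h2 *m w *m f *m (x *m y2) = 1%:M.
  by rewrite mulmxA -x2E -h2N -mulmxA -fNy.
exists (f *m (x *m y2) *m h2).
by rewrite -mulmxA h2N x2E mulmxA -(mulmxA f) uv mulmx1.
Qed.

(** * Solvability of the two-sided equation *)

Lemma two_sided_solve (divK : is_division_ring K) m n p1 p2 q1 q2
    (A : 'M[K]_(m, n)) (B : 'M[K]_(m, p1)) (C : 'M[K]_(m, p2))
    (D : 'M[K]_(q1, n)) (E : 'M[K]_(q2, n)) Z1 W1 Z2 W2 Z3 W3 Z4 W4 :
  A = C *m Z1 + B *m W1 -> A = Z2 *m D + W2 *m E ->
  A = B *m Z3 + W3 *m E -> A = C *m Z4 + W4 *m D ->
  exists X Y, B *m X *m D + C *m Y *m E = A.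
Proof.
move=> A1 A2 A3 A4.
have [B' BB] := inner_inverse divK B; have [C' CC] := inner_inverse divK C.
have [D' DD] := inner_inverse divK D; have [E' EE] := inner_inverse divK E.
pose RB := 1%:M - B *m B'; pose LD := 1%:M - D' *m D.
have RBB : RB *m B = 0 by rewrite mulmxBl mul1mx BB subrr.
have DLD : D *m LD = 0 by rewrite mulmxBr mulmx1 mulmxA DD subrr.
pose G := RB *m C; pose H := E *m LD.
have [G' GG] := inner_inverse divK G; have [H' HH] := inner_inverse divK H.
pose M := RB *m A; pose N := A *m LD.
(* Under [RB] or [LD] each form of [A] loses one term. What remains gives the solvability conditions
   of [G Y E = M] and [C Y H = N]; [MN] makes the two equations compatible. *)
have MG : G *m G' *m M = M.
  by rewrite /M A1 mulmxDr !(mulmxA RB) RBB mul0mx addr0 -/G mulmxA GG.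
have ME : M *m E' *m E = M.
  rewrite /M A3 mulmxDr !(mulmxA RB) RBB mul0mx add0r -2!mulmxA.
  by rewrite !(mulmxA E) EE.
have NC : C *m C' *m N = N.
  by rewrite /N A4 mulmxDl -!(mulmxA _ _ LD) DLD mulmx0 addr0 !mulmxA CC.
have NH : N *m H' *m H = N.
  rewrite /N A2 mulmxDl -(mulmxA Z2) DLD mulmx0 add0r -(mulmxA W2) -/H.
  by rewrite -!(mulmxA W2) HH.
have MN : M *m LD = RB *m N by rewrite mulmxA.
have GC : RB *m C = G by []; have HE : E *m LD = H by [].
have MA : RB *m A = M by []; have NA : A *m LD = N by [].
clearbody M N G H.
(* The first summand [G' M E'] of [Y] solves [G Y E = M], but contributes only [C G' RB N] to
   [C Y H]. The product [C u] is the missing part, and [G u = 0] leaves the first equation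
   intact. *)
pose u := C' *m (N - C *m G' *m (RB *m N)).
have Cu : C *m u = N - C *m G' *m (RB *m N).
  by rewrite /u mulmxA mulmxBr NC !mulmxA CC.
have Gu : G *m u = 0.
  by rewrite -GC -mulmxA Cu mulmxBr -MN !mulmxA GC MG subrr.
have uH : u *m H' *m H = u.
  by rewrite /u -!mulmxA (mulmxBl N) -!mulmxA (mulmxA N) NH.
clearbody u; pose Y := G' *m M *m E' + (1%:M - G' *m G) *m u *m H'.
have uE : (1%:M - G' *m G) *m u = u.
  by rewrite mulmxBl mul1mx -mulmxA Gu mulmx0 subr0.
have GYE : G *m Y *m E = M.
  by rewrite /Y uE mulmxDr mulmxDl !mulmxA MG ME Gu !mul0mx addr0.
have CYH : C *m Y *m H = N.
  rewrite /Y uE mulmxDr mulmxDl -!mulmxA (mulmxA u) uH Cu -HE !mulmxA.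
  rewrite -(mulmxA _ M) -(mulmxA _ (M *m E')) ME -(mulmxA _ M) MN !mulmxA.
  by rewrite addrC subrK.
(* The residual [A - C Y E] is killed by [RB] on the left and by [LD] on the right, so [B B'] and
   [D' D] fix it. *)
clearbody Y; exists (B' *m (A - C *m Y *m E) *m D'), Y.
have RBT : B *m B' *m (A - C *m Y *m E) = A - C *m Y *m E.
  apply/esym/eqP; rewrite -subr_eq0 -{1}[A - _]mul1mx -mulmxBl mulmxBr !mulmxA.
  by rewrite -/RB MA GC GYE subrr.
have TLD : (A - C *m Y *m E) *m D' *m D = A - C *m Y *m E.
  apply/esym/eqP; rewrite -subr_eq0 -{1}[A - _]mulmx1 -(mulmxA _ D') -mulmxBr.
  by rewrite mulmxBl -/LD NA -(mulmxA _ E) HE CYH subrr.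
by rewrite !mulmxA RBT TLD subrK.
Qed.

(** [N] is always a right multiple of [row_mx A N]; equal ranks provide the converse. *)
Lemma rank_row_mx_eq (divK : is_division_ring K) m n k (A : 'M[K]_(m, n))
    (N : 'M[K]_(m, k)) :
  rank (row_mx A N) = rank N <-> exists Z, A = N *m Z.
Proof.
have NM : N = row_mx A N *m col_mx 0 1%:M.
  by rewrite mul_row_col mulmx0 mulmx1 add0r.
split=> [/(rank_eq_mulr divK NM)[z]|[Z AZ]].
  by rewrite -{1}[z]hsubmxK mul_mx_row => /eq_row_mx[-> _]; exists (lsubmx z).
apply: (@rank_mulr_eq _ _ _ _ _ (row_mx Z 1%:M) _ _ NM).
by rewrite mul_mx_row -AZ mulmx1.
Qed.

Lemma rank_col_mx_eq (divK : is_division_ring K) m n k (A : 'M[K]_(m, n))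
    (N : 'M[K]_(k, n)) :
  rank (col_mx A N) = rank N <-> exists Z, A = Z *m N.
Proof.
have NM : N = row_mx 0 1%:M *m col_mx A N.
  by rewrite mul_row_col mul0mx mul1mx add0r.
split=> [/(rank_eq_mull divK NM)[z]|[Z AZ]].
  by rewrite -{1}[z]vsubmxK mul_col_mx => /eq_col_mx[-> _]; exists (usubmx z).
apply: (@rank_mull_eq divK _ _ _ _ _ (col_mx Z 1%:M) _ _ NM).
by rewrite mul_col_mx -AZ mul1mx.
Qed.

(** The row operation [U W] adds [W E] to the corner, and a column operation adds [B Z]; neither
    changes the rank. *)
Lemma rank_block_mx_eq (divK : is_division_ring K) m n p q (A : 'M[K]_(m, n))
    (B : 'M[K]_(m, p)) (E : 'M[K]_(q, n)) :
  rank (block_mx A B E 0) = rank (block_mx 0 B E 0) <->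
  exists Z W, A = B *m Z + W *m E.
Proof.
pose U (W : 'M[K]_(m, q)) : 'M[K]_(m + q) := block_mx 1%:M W 0 1%:M.
have UM W A' : U W *m block_mx A' B E 0 = block_mx (A' + W *m E) B E 0.
  by rewrite mulmx_block !(mulmx0, mul1mx, mul0mx, addr0, add0r).
have rkU W A' : rank (block_mx (A' + W *m E) B E 0) = rank (block_mx A' B E 0).
  apply: (rank_mull_eq divK (esym (UM W A')) (y := U (- W))).
  by rewrite UM mulNmx addrK.
split=> [rkA|[Z [W ->]]]; last first.
  rewrite rkU; apply: (@rank_mulr_eq _ _ _ _ _ (block_mx 1%:M 0 Z 1%:M)
    (block_mx 1%:M 0 (- Z) 1%:M)).
    by rewrite mulmx_block !(mulmx0, mulmx1, mul0mx, addr0, add0r).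
  by rewrite mulmx_block !(mulmx0, mulmx1, mul0mx, addr0, add0r) mulmxN subrr.
have [E' EE] := inner_inverse divK E.
(* Once the corner is reduced to [A - A E' E], multiplying it by [E' E] on the right gives zero. The
   matrix with zero corner is thus a right multiple of the reduced one, and equal ranks reverse
   this, writing the reduced corner as [B Z]. *)
have NM : block_mx 0 B E 0 =
    block_mx (A + - (A *m E') *m E) B E 0 *m block_mx (E' *m E) 0 0 1%:M.
  rewrite mulmx_block !(mulmx0, mulmx1, mul0mx, addr0, add0r) mulmxDl mulNmx.
  by rewrite mulNmx -!mulmxA (mulmxA E) EE subrr.
have [|z] := rank_eq_mulr divK NM; first by rewrite rkU.
rewrite -[z]submxK mulmx_block => /eq_block_mx[+ _ _ _].
rewrite mul0mx add0r mulNmx => /eqP; rewrite subr_eq => /eqP AE.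
by exists (dlsubmx z), (A *m E').
Qed.

Lemma two_sided_consistent (divK : is_division_ring K) m n p1 p2 q1 q2
    (A : 'M[K]_(m, n)) (B : 'M[K]_(m, p1)) (C : 'M[K]_(m, p2))
    (D : 'M[K]_(q1, n)) (E : 'M[K]_(q2, n)) :
  (exists X Y, B *m X *m D + C *m Y *m E = A) <->
  [/\ rank (row3 A C B) = rank (row_mx C B),
      rank (col3 A D E) = rank (col_mx D E),
      rank (block_mx A B E 0) = rank (block_mx 0 B E 0)
    & rank (block_mx A C D 0) = rank (block_mx 0 C D 0)].
Proof.
split=> [[X [Y <-]]|[]].
  split.
  - apply/(rank_row_mx_eq divK); exists (col_mx (Y *m E) (X *m D)).
    by rewrite mul_row_col !mulmxA addrC.
  - apply/(rank_col_mx_eq divK); exists (row_mx (B *m X) (C *m Y)).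
    by rewrite mul_row_col.
  - by apply/(rank_block_mx_eq divK); exists (X *m D), (C *m Y); rewrite mulmxA.
  - apply/(rank_block_mx_eq divK); exists (Y *m E), (B *m X).
    by rewrite mulmxA addrC.
move=> /(rank_row_mx_eq divK)[z1 A1] /(rank_col_mx_eq divK)[z2 A2].
move=> /(rank_block_mx_eq divK)[Z3 [W3 A3]].
move=> /(rank_block_mx_eq divK)[Z4 [W4 A4]].
rewrite -[z1]vsubmxK mul_row_col in A1; rewrite -[z2]hsubmxK mul_row_col in A2.
exact: (two_sided_solve divK A1 A2 A3 A4).
Qed.

End DivisionRing.

(** * Calculus of 3 by 3 and 7 by 7 block matrices *)

Section BlockMatrices.
Variable K : nzRingType.

Lemma mul_row3_col3 m n k1 k2 k3 (a1 : 'M[K]_(m, k1)) (a2 : 'M_(m, k2))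
    (a3 : 'M_(m, k3)) (b1 : 'M_(k1, n)) (b2 : 'M_(k2, n)) (b3 : 'M_(k3, n)) :
  row3 a1 a2 a3 *m col3 b1 b2 b3 = a1 *m b1 + a2 *m b2 + a3 *m b3.
Proof. by rewrite !mul_row_col addrA. Qed.

Lemma mul_mx_row3 m k n1 n2 n3 (x : 'M[K]_(m, k)) (a1 : 'M_(k, n1))
    (a2 : 'M_(k, n2)) (a3 : 'M_(k, n3)) :
  x *m row3 a1 a2 a3 = row3 (x *m a1) (x *m a2) (x *m a3).
Proof. by rewrite !mul_mx_row. Qed.

Lemma add_row3 m n1 n2 n3 (a1 b1 : 'M[K]_(m, n1)) (a2 b2 : 'M_(m, n2))
    (a3 b3 : 'M_(m, n3)) :
  row3 a1 a2 a3 + row3 b1 b2 b3 = row3 (a1 + b1) (a2 + b2) (a3 + b3).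
Proof. by rewrite !add_row_mx. Qed.

Lemma mul_mx_row7 m k n1 n2 n3 n4 n5 n6 n7 (x : 'M[K]_(m, k)) (a1 : 'M_(k, n1))
    (a2 : 'M_(k, n2)) (a3 : 'M_(k, n3)) (a4 : 'M_(k, n4)) (a5 : 'M_(k, n5))
    (a6 : 'M_(k, n6)) (a7 : 'M_(k, n7)) :
  x *m row7 a1 a2 a3 a4 a5 a6 a7 =
  row7 (x *m a1) (x *m a2) (x *m a3) (x *m a4) (x *m a5) (x *m a6) (x *m a7).
Proof. by rewrite !mul_mx_row. Qed.

Lemma add_row7 m n1 n2 n3 n4 n5 n6 n7 (a1 b1 : 'M[K]_(m, n1))
    (a2 b2 : 'M_(m, n2)) (a3 b3 : 'M_(m, n3)) (a4 b4 : 'M_(m, n4))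
    (a5 b5 : 'M_(m, n5)) (a6 b6 : 'M_(m, n6)) (a7 b7 : 'M_(m, n7)) :
  row7 a1 a2 a3 a4 a5 a6 a7 + row7 b1 b2 b3 b4 b5 b6 b7 =
  row7 (a1 + b1) (a2 + b2) (a3 + b3) (a4 + b4) (a5 + b5) (a6 + b6) (a7 + b7).
Proof. by rewrite !add_row_mx. Qed.

Lemma mul_col7_mx n k m1 m2 m3 m4 m5 m6 m7 (a1 : 'M[K]_(m1, k))
    (a2 : 'M_(m2, k)) (a3 : 'M_(m3, k)) (a4 : 'M_(m4, k)) (a5 : 'M_(m5, k))
    (a6 : 'M_(m6, k)) (a7 : 'M_(m7, k)) (x : 'M_(k, n)) :
  col7 a1 a2 a3 a4 a5 a6 a7 *m x =
  col7 (a1 *m x) (a2 *m x) (a3 *m x) (a4 *m x) (a5 *m x) (a6 *m x) (a7 *m x).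
Proof. by rewrite !mul_col_mx. Qed.

Lemma add_col7 n m1 m2 m3 m4 m5 m6 m7 (a1 b1 : 'M[K]_(m1, n))
    (a2 b2 : 'M_(m2, n)) (a3 b3 : 'M_(m3, n)) (a4 b4 : 'M_(m4, n))
    (a5 b5 : 'M_(m5, n)) (a6 b6 : 'M_(m6, n)) (a7 b7 : 'M_(m7, n)) :
  col7 a1 a2 a3 a4 a5 a6 a7 + col7 b1 b2 b3 b4 b5 b6 b7 =
  col7 (a1 + b1) (a2 + b2) (a3 + b3) (a4 + b4) (a5 + b5) (a6 + b6) (a7 + b7).
Proof. by rewrite !add_col_mx. Qed.

Lemma eq_row7 m n1 n2 n3 n4 n5 n6 n7 (a1 b1 : 'M[K]_(m, n1))
    (a2 b2 : 'M_(m, n2)) (a3 b3 : 'M_(m, n3)) (a4 b4 : 'M_(m, n4))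
    (a5 b5 : 'M_(m, n5)) (a6 b6 : 'M_(m, n6)) (a7 b7 : 'M_(m, n7)) :
  row7 a1 a2 a3 a4 a5 a6 a7 = row7 b1 b2 b3 b4 b5 b6 b7 ->
  [/\ [/\ a1 = b1, a2 = b2 & a3 = b3], a4 = b4, a5 = b5, a6 = b6 & a7 = b7].
Proof.
by do 5!case/eq_row_mx=> ?; case/eq_row_mx.
Qed.

Lemma eq_col7 n m1 m2 m3 m4 m5 m6 m7 (a1 b1 : 'M[K]_(m1, n))
    (a2 b2 : 'M_(m2, n)) (a3 b3 : 'M_(m3, n)) (a4 b4 : 'M_(m4, n))
    (a5 b5 : 'M_(m5, n)) (a6 b6 : 'M_(m6, n)) (a7 b7 : 'M_(m7, n)) :
  col7 a1 a2 a3 a4 a5 a6 a7 = col7 b1 b2 b3 b4 b5 b6 b7 ->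
  [/\ [/\ a1 = b1, a2 = b2 & a3 = b3], a4 = b4, a5 = b5, a6 = b6 & a7 = b7].
Proof.
by do 5!case/eq_col_mx=> ?; case/eq_col_mx.
Qed.

Lemma row7_0 m n1 n2 n3 n4 n5 n6 n7 :
  row7 0 0 0 0 0 0 0 = 0
    :> 'M[K]_(m, n1 + (n2 + (n3 + (n4 + (n5 + (n6 + n7)))))).
Proof. by rewrite /row7 !row_mx0. Qed.

Lemma mx_col3_row3 m1 m2 m3 n1 n2 n3
    (X : 'M[K]_(m1 + (m2 + m3), n1 + (n2 + n3))) :
  exists X1 X2 X3 X4 X5 X6 X7 X8 X9,
    X = col3 (row3 X1 X2 X3) (row3 X4 X5 X6) (row3 X7 X8 X9).
Proof.
have rowP m (M : 'M[K]_(m, n1 + (n2 + n3))) : exists a b c, M = row3 a b c.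
  exists (lsubmx M), (lsubmx (rsubmx M)), (rsubmx (rsubmx M)).
  by rewrite /row3 !hsubmxK.
have [X1 [X2 [X3 E1]]] := rowP _ (usubmx X).
have [X4 [X5 [X6 E2]]] := rowP _ (usubmx (dsubmx X)).
have [X7 [X8 [X9 E3]]] := rowP _ (dsubmx (dsubmx X)).
exists X1, X2, X3, X4, X5, X6, X7, X8, X9.
by rewrite -E1 -E2 -E3 /col3 !vsubmxK.
Qed.

(** Turns an identity block forced to vanish into a constraint on its size. *)
Lemma scalar1_eq0 k : 1%:M = 0 :> 'M[K]_k -> k = 0%N.
Proof.
case: k => // k /matrixP/(_ 0 0)/eqP.
by rewrite !mxE eqxx oner_eq0.
Qed.

(** * The equation between the canonical matrices *)

Section Canonical.
Variables m1 m2 m3 m4 m5 m6 m7 n2 n3 n4 n7 p3 p1' q3 q1' : nat.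
Variables (A1 : 'M[K]_(m2, n2)) (A2 : 'M[K]_(m2, n3)) (A3 : 'M[K]_(m2, n4)).
Variables (A4 : 'M[K]_(m3, n2)) (A5 : 'M[K]_(m3, n3)) (A6 : 'M[K]_(m3, n4)).
Variables (A7 : 'M[K]_(m4, n2)) (A8 : 'M[K]_(m4, n3)) (A9 : 'M[K]_(m4, n4)).
Variables (B1 : 'M[K]_(m1, p3)) (C1 : 'M[K]_(m1, p1')) (C2 : 'M[K]_(m1, m3)).
Variables (D1 : 'M[K]_(q3, m6)) (E1 : 'M[K]_(q1', m6)) (E2 : 'M[K]_(n3, m6)).

(** Together with [canon_B] to [canon_E], this is the block data of [simdec] with independent sizes
    and no casts. *)
Definition canon_A : 'M[K]_(m1 + (m2 + (m3 + (m4 + (m5 + (m6 + m7))))),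
                       m6 + (n2 + (n3 + (n4 + (m5 + (m1 + n7)))))) := col7
    (row7 0 0 0 0 0 1%:M 0)
    (row7 0 A1 A2 A3 0 0 0)
    (row7 0 A4 A5 A6 0 0 0)
    (row7 0 A7 A8 A9 0 0 0)
    (row7 0 0 0 0 1%:M 0 0)
    (row7 1%:M 0 0 0 0 0 0)
    (row7 0 0 0 0 0 0 0).

Definition canon_B : 'M[K]_(m1 + (m2 + (m3 + (m4 + (m5 + (m6 + m7))))),
                       m2 + (m3 + p3)) := col7
    (row3 0 0 B1)
    (row3 1%:M 0 0)
    (row3 0 1%:M 0)
    (row3 0 0 0)
    (row3 0 0 0)
    (row3 0 0 0)
    (row3 0 0 0).

Definition canon_C : 'M[K]_(m1 + (m2 + (m3 + (m4 + (m5 + (m6 + m7))))),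
                       p1' + (m3 + m4)) := col7
    (row3 C1 C2 0)
    (row3 0 0 0)
    (row3 0 1%:M 0)
    (row3 0 0 1%:M)
    (row3 0 0 0)
    (row3 0 0 0)
    (row3 0 0 0).

Definition canon_D : 'M[K]_(n2 + (n3 + q3),
                       m6 + (n2 + (n3 + (n4 + (m5 + (m1 + n7)))))) := col3
    (row7 0 1%:M 0 0 0 0 0)
    (row7 0 0 1%:M 0 0 0 0)
    (row7 D1 0 0 0 0 0 0).

Definition canon_E : 'M[K]_(q1' + (n3 + n4),
                       m6 + (n2 + (n3 + (n4 + (m5 + (m1 + n7)))))) := col3
    (row7 E1 0 0 0 0 0 0)
    (row7 E2 0 1%:M 0 0 0 0)
    (row7 0 0 0 1%:M 0 0 0).

Lemma canonical_lhs X1 X2 X3 X4 X5 X6 X7 X8 X9 Y1 Y2 Y3 Y4 Y5 Y6 Y7 Y8 Y9 :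
  canon_B *m col3 (row3 X1 X2 X3) (row3 X4 X5 X6) (row3 X7 X8 X9) *m canon_D +
  canon_C *m col3 (row3 Y1 Y2 Y3) (row3 Y4 Y5 Y6) (row3 Y7 Y8 Y9) *m canon_E =
  col7
   (row7 (B1 *m X9 *m D1 + ((C1 *m Y1 + C2 *m Y4) *m E1 +
                            (C1 *m Y2 + C2 *m Y5) *m E2))
      (B1 *m X7) (B1 *m X8 + (C1 *m Y2 + C2 *m Y5)) (C1 *m Y3 + C2 *m Y6) 0 0 0)
   (row7 (X3 *m D1) X1 X2 0 0 0 0)
   (row7 (X6 *m D1 + (Y4 *m E1 + Y5 *m E2)) X4 (X5 + Y5) Y6 0 0 0)
   (row7 (Y7 *m E1 + Y8 *m E2) 0 Y8 Y9 0 0 0)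
   0 0 0.
Proof.
rewrite !mul_col7_mx !mul_row3_col3 !(mul0mx, mul1mx, add0r, addr0).
rewrite !mul_mx_row3 add_row3 !mul_row3_col3 !mul_mx_row7 !add_row7.
rewrite add_col7 !(mul0mx, mulmx0, mulmx1, add0r, addr0).
by rewrite !add_row7 !(add0r, addr0).
Qed.

(** By [canonical_lhs] the left side is zero, whatever the unknowns, at the three identity blocks of
    [canon_A] and at the positions of [A3] and [A7]. *)
Lemma canonical_sizes (X : 'M_(m2 + (m3 + p3), n2 + (n3 + q3)))
    (Y : 'M_(p1' + (m3 + m4), q1' + (n3 + n4))) :
  canon_B *m X *m canon_D + canon_C *m Y *m canon_E = canon_A ->
  [/\ m1 = 0%N, m5 = 0%N, m6 = 0%N, A3 = 0 & A7 = 0].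
Proof.
have [X1 [X2 [X3 [X4 [X5 [X6 [X7 [X8 [X9 ->]]]]]]]]] := mx_col3_row3 X.
have [Y1 [Y2 [Y3 [Y4 [Y5 [Y6 [Y7 [Y8 [Y9 ->]]]]]]]]] := mx_col3_row3 Y.
rewrite canonical_lhs -!row7_0 => /eq_col7[[r1 r2 _] r4 r5 r6 _].
have [_ _ _ /esym/scalar1_eq0 m1_0 _] := eq_row7 r1.
have [_ /esym A3_0 _ _ _] := eq_row7 r2.
have [[_ /esym A7_0 _] _ _ _ _] := eq_row7 r4.
have [_ _ /esym/scalar1_eq0 m5_0 _ _] := eq_row7 r5.
by have [[/esym/scalar1_eq0 m6_0 _ _] _ _ _ _] := eq_row7 r6.
Qed.

Lemma canonical_solutions (X : 'M_(m2 + (m3 + p3), n2 + (n3 + q3)))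
    (Y : 'M_(p1' + (m3 + m4), q1' + (n3 + n4))) :
  m1 = 0%N -> m5 = 0%N -> m6 = 0%N -> A3 = 0 -> A7 = 0 ->
  canon_B *m X *m canon_D + canon_C *m Y *m canon_E = canon_A <->
  exists X3 X5 X6 X7 X8 X9 Y1 Y2 Y3 Y4 Y7,
    X = col3 (row3 A1 A2 X3) (row3 A4 X5 X6) (row3 X7 X8 X9) /\
    Y = col3 (row3 Y1 Y2 Y3) (row3 Y4 (A5 - X5) A6) (row3 Y7 A8 A9).
Proof.
move=> m1_0 m5_0 m6_0 A3_0 A7_0; split.
  have [X1 [X2 [X3 [X4 [X5 [X6 [X7 [X8 [X9 ->]]]]]]]]] := mx_col3_row3 X.
  have [Y1 [Y2 [Y3 [Y4 [Y5 [Y6 [Y7 [Y8 [Y9 ->]]]]]]]]] := mx_col3_row3 Y.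
  rewrite canonical_lhs => /eq_col7[[_ r2 r3] r4 _ _ _].
  have [[_ -> ->] _ _ _ _] := eq_row7 r2.
  (* Only the position of [A5] couples the two unknowns, through [X5 + Y5 = A5]; hence [X5] stays
     free and determines [Y5]. *)
  have [[_ -> <-] -> _ _ _] := eq_row7 r3.
  have [[_ _ ->] -> _ _ _] := eq_row7 r4.
  exists X3, X5, X6, X7, X8, X9, Y1, Y2, Y3, Y4, Y7.
  by rewrite [X5 + Y5]addrC addrK.
move=> [X3 [X5 [X6 [X7 [X8 [X9 [Y1 [Y2 [Y3 [Y4 [Y7 [-> ->]]]]]]]]]]]].
have flat k n (M N : 'M[K]_(k, n)) : (k = 0)%N -> M = N.
  by move=> k_0; move: M N; rewrite k_0 => M N; rewrite !flatmx0.
have thin k n (M N : 'M[K]_(n, k)) : (k = 0)%N -> M = N.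
  by move=> k_0; move: M N; rewrite k_0 => M N; rewrite !thinmx0.
rewrite canonical_lhs [X5 + _]addrC subrK /canon_A A3_0 A7_0 row7_0.
(* The block rows of sizes [m1], [m5], [m6] are empty. In the others, the products with [D1], [E1],
   [E2] lie in the first block column, empty since [m6 = 0]. *)
by congr col7; try exact: flat; congr row7; exact: thin.
Qed.

End Canonical.

(** * Transport along the nonsingular factors of a decomposition *)

Lemma mul_nonsingular_inj m n (P : 'M[K]_m) (Q : 'M[K]_n)
    (M N : 'M[K]_(m, n)) :
  nonsingular P -> nonsingular Q -> P *m M *m Q = P *m N *m Q -> M = N.
Proof.
move=> [P' [_ P'P]] [Q' [QQ' _]] /(congr1 (fun Z => P' *m Z *m Q')).
by rewrite -!mulmxA QQ' !mulmx1 !mulmxA P'P !mul1mx.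
Qed.

Lemma mxinverseP n (P : 'M[K]_n) :
  nonsingular P -> is_mxinverse P (mxinverse P).
Proof. by case=> P' PP'; apply: xgetI PP'. Qed.

(** The outer factors [P] and [Q] cancel; the inner ones are absorbed into the unknowns. *)
Lemma two_sided_equivalent m n p1 p2 q1 q2 (A : 'M[K]_(m, n))
    (B : 'M[K]_(m, p1)) (C : 'M[K]_(m, p2)) (D : 'M[K]_(q1, n))
    (E : 'M[K]_(q2, n)) (P : 'M[K]_m) (Q : 'M[K]_n) (T1 : 'M[K]_p1)
    (T2 : 'M[K]_p2) (V1 : 'M[K]_q1) (V2 : 'M[K]_q2)
    (X : 'M[K]_(p1, q1)) (Y : 'M[K]_(p2, q2)) :
  nonsingular P -> nonsingular Q ->
  (P *m B *m T1) *m X *m (V1 *m D *m Q) +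
  (P *m C *m T2) *m Y *m (V2 *m E *m Q) = P *m A *m Q <->
  B *m (T1 *m X *m V1) *m D + C *m (T2 *m Y *m V2) *m E = A.
Proof.
move=> nsP nsQ.
have -> : (P *m B *m T1) *m X *m (V1 *m D *m Q) +
          (P *m C *m T2) *m Y *m (V2 *m E *m Q) =
    P *m (B *m (T1 *m X *m V1) *m D + C *m (T2 *m Y *m V2) *m E) *m Q.
  by rewrite mulmxDr mulmxDl !mulmxA.
by split=> [/(mul_nonsingular_inj nsP nsQ)|->].
Qed.

Lemma eq_mxinverse_mul m n (T : 'M[K]_m) (V : 'M[K]_n) (X Z : 'M[K]_(m, n)) :
  nonsingular T -> nonsingular V ->
  X = mxinverse T *m Z *m mxinverse V <-> T *m X *m V = Z.
Proof.
move=> /mxinverseP[TT' T'T] /mxinverseP[VV' V'V]; split=> [->|<-].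
  by rewrite -!mulmxA V'V mulmx1 mulmxA TT' mul1mx.
by rewrite -!mulmxA VV' mulmx1 mulmxA T'T mul1mx.
Qed.

End BlockMatrices.

Theorem theorem4p1 (R : realType) (m n p1 p2 q1 q2 : nat)
    (A : 'M[quat R]_(m, n)) (B : 'M[quat R]_(m, p1)) (C : 'M[quat R]_(m, p2))
    (D : 'M[quat R]_(q1, n)) (E : 'M[quat R]_(q2, n)) :
  ((exists (X : 'M[quat R]_(p1, q1)) (Y : 'M[quat R]_(p2, q2)),
      B *m X *m D + C *m Y *m E = A)
   <->
   [/\ rank (row3 A C B) = rank (row_mx C B),
       rank (col3 A D E) = rank (col_mx D E),
       rank (block_mx A B E 0) = rank (block_mx 0 B E 0)
     & rank (block_mx A C D 0) = rank (block_mx 0 C D 0)])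
  /\
  ((exists (X : 'M[quat R]_(p1, q1)) (Y : 'M[quat R]_(p2, q2)),
      B *m X *m D + C *m Y *m E = A) ->
   forall (S : simdec A B C D E)
          (X : 'M[quat R]_(p1, q1)) (Y : 'M[quat R]_(p2, q2)),
     B *m X *m D + C *m Y *m E = A
     <->
     exists (X3 : 'M[quat R]_(sd_m2 S, sd_q3 S))
            (X5 : 'M[quat R]_(sd_m3 S, sd_n3 S))
            (X6 : 'M[quat R]_(sd_m3 S, sd_q3 S))
            (X7 : 'M[quat R]_(sd_p3 S, sd_n2 S))
            (X8 : 'M[quat R]_(sd_p3 S, sd_n3 S))
            (X9 : 'M[quat R]_(sd_p3 S, sd_q3 S))
            (Y1 : 'M[quat R]_(sd_p1' S, sd_q1' S))
            (Y2 : 'M[quat R]_(sd_p1' S, sd_n3 S))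
            (Y3 : 'M[quat R]_(sd_p1' S, sd_n4 S))
            (Y4 : 'M[quat R]_(sd_m3 S, sd_q1' S))
            (Y7 : 'M[quat R]_(sd_m4 S, sd_q1' S)),
       X = mxinverse (sd_T1 S)
             *m castmx (sd_eqp1 S, sd_eqq1 S)
                  (col3 (row3 (sd_A1 S) (sd_A2 S) X3)
                        (row3 (sd_A4 S) X5 X6)
                        (row3 X7 X8 X9))
             *m mxinverse (sd_V1 S)
       /\
       Y = mxinverse (sd_T2 S)
             *m castmx (sd_eqp2 S, sd_eqq2 S)
                  (col3 (row3 Y1 Y2 Y3)
                        (row3 Y4 (sd_A5 S - X5) (sd_A6 S))
                        (row3 Y7 (sd_A8 S) (sd_A9 S)))
             *m mxinverse (sd_V2 S)).
Proof.
split; first exact: (two_sided_consistent (@quat_division_ring R)).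
move=> [X0 [Y0 sol]] S X Y.
case: S => m1 m2 m3 m4 m5 m6 m7 n2 n3 n4 n7 p3 p1' q3 q1'.
move=> eqm eqn eqp1 eqp2 eqq1 eqq2.
move=> P Q T1 T2 V1 V2 A1 A2 A3 A4 A5 A6 A7 A8 A9 B1 C1 C2 D1 E1 E2.
move=> nsP nsQ nsT1 nsT2 nsV1 nsV2 eqA eqB eqC eqD eqE _ /=.
(* Eliminating the six outer sizes makes every cast an identity, and the block matrices become the
   canonical ones. *)
subst m n p1 p2 q1 q2; rewrite !castmx_id in eqA eqB eqC eqD eqE *.
rewrite {}eqA {}eqB {}eqC {}eqD {}eqE in sol *.
(* Consistency enters here: the given solution [X0], [Y0] forces the vanishing conditions under
   which [canonical_solutions] describes all solutions. *)
have [m1_0 m5_0 m6_0 A3_0 A7_0] :=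
  canonical_sizes ((two_sided_equivalent _ _ _ _ _ _ _ _ _ _ _ nsP nsQ).1 sol).
apply: iff_trans; first exact: two_sided_equivalent.
apply: iff_trans; first exact: canonical_solutions.
split=> -[X3 [X5 [X6 [X7 [X8 [X9 [Y1 [Y2 [Y3 [Y4 [Y7 [XE YE]]]]]]]]]]]];
  exists X3, X5, X6, X7, X8, X9, Y1, Y2, Y3, Y4, Y7.
  by rewrite !castmx_id; split; apply/eq_mxinverse_mul.
by rewrite !castmx_id in XE YE; split; apply/eq_mxinverse_mul.
Qed.
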